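(* Let $G^\sigma$ be a $4$-regular oriented graph with optimum skew energy. If the underlying graph $G$ is triangle-free, then $G$ is isomorphic to one of the following: the $4$-dimensional hypercube $Q_4$; the graph $G_3$; the graph $\mathcal{G}_i$ for some positive integer $i$; or the graph $\mathcal{H}_j$ for some positive integer $j$.
   Context: For a simple undirected graph $G$ on $n$ vertices $v_1,\dots,v_n$, an orientation $\sigma$ yields an oriented graph $G^\sigma$ with skew-adjacency matrix $S(G^\sigma)=[s_{ij}]$, where $s_{ij}=1$, $s_{ji}=-1$ if $\langle v_i,v_j\rangle$ is an arc and $s_{ij}=s_{ji}=0$ otherwise. The skew energy $\mathcal{E}_S(G^\sigma)$ is the sum of the absolute values of the eigenvalues of $S(G^\sigma)$; $G^\sigma$ has optimum skew energy if $\mathcal{E}_S(G^\sigma)=n\sqrt{\Delta}$, $\Delta$ the maximum degree (equivalently $S(G^\sigma)^TS(G^\sigma)=\Delta I_n$). $G_3$ is the graph on the $14$ vertices $u,v,u_1,\dots,u_6,v_1,\dots,v_5,w$ with the $28$ edges $uu_1,uu_2,uv_1,uv_2,vu_1,vu_2,vu_5,vu_6,u_1u_3,u_1u_4,u_2v_3,u_2v_4,v_1u_3,v_1v_3,v_1w,v_2u_4,v_2v_4,v_2w,u_3u_5,u_3v_5,u_4u_6,u_4v_5,v_3u_6,v_3v_5,v_4u_5,v_4v_5,wu_5,wu_6$. For a positive integer $i$, $\mathcal{G}_i$ is the graph on the $4i+6$ vertices $u,v,u_1,\dots,u_{2i+2},v_1,\dots,v_{2i+2}$ whose edges are: $u$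 and $v$ are each adjacent to $u_1,u_2,v_1,v_2$; for each $k=1,\dots,i$, each of $u_{2k-1},u_{2k}$ is adjacent to each of $u_{2k+1},u_{2k+2}$, and each of $v_{2k-1},v_{2k}$ is adjacent to each of $v_{2k+1},v_{2k+2}$; and the $4$-cycle $u_{2i+1}v_{2i+2}u_{2i+2}v_{2i+1}u_{2i+1}$ (edges $u_{2i+1}v_{2i+2},v_{2i+2}u_{2i+2},u_{2i+2}v_{2i+1},v_{2i+1}u_{2i+1}$). For a positive integer $j$, $\mathcal{H}_j$ is the graph on the $4j+4$ vertices $u,v,u_1,\dots,u_{2j+2},v_1,\dots,v_{2j}$ whose edges are: $u$ and $v$ are each adjacent to $u_1,u_2,v_1,v_2$; for each $k=1,\dots,j$, each of $u_{2k-1},u_{2k}$ is adjacent to each of $u_{2k+1},u_{2k+2}$; for each $k=1,\dots,j-1$, each of $v_{2k-1},v_{2k}$ is adjacent to each of $v_{2k+1},v_{2k+2}$; and each of $v_{2j-1},v_{2j}$ is adjacent to each of $u_{2j+1},u_{2j+2}$. (In particular $\mathcal{H}_1\cong K_{4,4}$.)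
   Formalization: The graph G is additionally assumed connected (and non-empty); without this the claim fails, e.g. for two disjoint copies of K_{4,4} with optimum orientations, since every listed graph is connected. *)

(* Defs.v *)
From mathcomp Require Import all_boot all_order all_algebra.

Set Implicit Arguments.
Unset Strict Implicit.
Unset Printing Implicit Defensive.

Import GRing.Theory Num.Theory.

(* A simple undirected graph is a symmetric irreflexive relation on its
   vertices. *)

Definition simple_graph (T : finType) (e : rel T) : Prop :=
  symmetric e /\ irreflexive e.

Definition degree (T : finType) (e : rel T) (x : T) : nat := #|[set y | e x y]|.

Definition max_degree (T : finType) (e : rel T) : nat :=
  \max_(x : T) degree e x.

Definition regular (T : finType) (k : nat) (e : rel T) : Prop :=
  forall x, degree e x = k.

(* Skew-energy optimality passes to disjoint unions of regular graphs of the same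
   degree (e.g. two copies of K_{4,4}), so the classification is one of
   connected graphs. *)
Definition connected_graph (T : finType) (e : rel T) : Prop :=
  0 < #|T| /\ forall x y, connect e x y.

Definition triangle_free (T : finType) (e : rel T) : Prop :=
  forall x y z, ~ [/\ e x y, e y z & e z x].

Definition graph_iso (T1 T2 : finType) (e1 : rel T1) (e2 : rel T2) : Prop :=
  exists f : T1 -> T2, bijective f /\ forall x y, e2 (f x) (f y) = e1 x y.

(* [arc x y] stands for the arc <x, y>: every edge of [e] carries exactly one
   of its two directions, and there are no other arcs. *)
Definition orientation (T : finType) (e arc : rel T) : Prop :=
  (forall x y, e x y = arc x y || arc y x) /\
  (forall x y, ~~ (arc x y && arc y x)).

Section SkewEnergy.
Local Open Scope ring_scope.

Definition skew_adj (C : numClosedFieldType) (n : nat) (arc : rel 'I_n) :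
    'M[C]_n :=
  \matrix_(i, j) (if arc i j then 1 else if arc j i then -1 else 0).

(* The eigenvalues, repeated according to their algebraic multiplicity. *)
Definition eigenvalues (C : numClosedFieldType) (n : nat) (A : 'M[C]_n) :
    seq C :=
  sval (closed_field_poly_normal (char_poly A)).

Definition skew_energy (C : numClosedFieldType) (n : nat) (arc : rel 'I_n) : C :=
  \sum_(z <- eigenvalues (skew_adj C arc)) `|z|.

Definition optimum_skew_energy (C : numClosedFieldType) (n : nat)
    (e arc : rel 'I_n) : Prop :=
  skew_energy C arc = n%:R * sqrtC (max_degree e)%:R.

End SkewEnergy.

Definition hypercube (d : nat) : rel {ffun 'I_d -> bool} :=
  fun x y => #|[set i | x i != y i]| == 1.

Arguments hypercube : clear implicits.

(* The graph on 0, ..., n-1 with a given list of unordered edges. *)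
Definition graph_of_edges (n : nat) (E : seq (nat * nat)) : rel 'I_n :=
  fun x y => ((val x, val y) \in E) || ((val y, val x) \in E).

(* All edges between two lists of vertices. *)
Definition join (A B : seq nat) : seq (nat * nat) :=
  [seq (a, b) | a <- A, b <- B].

(* Numbering of the vertices u, v, u_1, ..., u_m, v_1, v_2, ... (in this order)
   by 0, 1, 2, ...; the subscripts start at 1. *)
Definition vtx_u : nat := 0.
Definition vtx_v : nat := 1.
Definition vtx_ui (k : nat) : nat := k.+1.
Definition vtx_vi (m k : nat) : nat := m.+1 + k.

Definition G3_edges : seq (nat * nat) :=
  let u := vtx_u in let v := vtx_v in
  let u_ := vtx_ui in let v_ := vtx_vi 6 in
  let w := 13 in
  [:: (u, u_ 1); (u, u_ 2); (u, v_ 1); (u, v_ 2);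
      (v, u_ 1); (v, u_ 2); (v, u_ 5); (v, u_ 6);
      (u_ 1, u_ 3); (u_ 1, u_ 4); (u_ 2, v_ 3); (u_ 2, v_ 4);
      (v_ 1, u_ 3); (v_ 1, v_ 3); (v_ 1, w);
      (v_ 2, u_ 4); (v_ 2, v_ 4); (v_ 2, w);
      (u_ 3, u_ 5); (u_ 3, v_ 5); (u_ 4, u_ 6); (u_ 4, v_ 5);
      (v_ 3, u_ 6); (v_ 3, v_ 5); (v_ 4, u_ 5); (v_ 4, v_ 5);
      (w, u_ 5); (w, u_ 6)].

Definition graph_G3 : rel 'I_14 := graph_of_edges G3_edges.

Definition calG_edges (i : nat) : seq (nat * nat) :=
  let u := vtx_u in let v := vtx_v in
  let u_ := vtx_ui in let v_ := vtx_vi (2 * i + 2) in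
  join [:: u; v] [:: u_ 1; u_ 2; v_ 1; v_ 2]
  ++ flatten [seq join [:: u_ (2 * k - 1); u_ (2 * k)]
                       [:: u_ (2 * k + 1); u_ (2 * k + 2)]
                  ++ join [:: v_ (2 * k - 1); v_ (2 * k)]
                          [:: v_ (2 * k + 1); v_ (2 * k + 2)]
             | k <- iota 1 i]
  ++ [:: (u_ (2 * i + 1), v_ (2 * i + 2)); (v_ (2 * i + 2), u_ (2 * i + 2));
         (u_ (2 * i + 2), v_ (2 * i + 1)); (v_ (2 * i + 1), u_ (2 * i + 1))].

Definition graph_calG (i : nat) : rel 'I_(4 * i + 6) :=
  graph_of_edges (calG_edges i).

Definition calH_edges (j : nat) : seq (nat * nat) :=
  let u := vtx_u in let v := vtx_v in
  let u_ := vtx_ui in let v_ := vtx_vi (2 * j + 2) in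
  join [:: u; v] [:: u_ 1; u_ 2; v_ 1; v_ 2]
  ++ flatten [seq join [:: u_ (2 * k - 1); u_ (2 * k)]
                       [:: u_ (2 * k + 1); u_ (2 * k + 2)]
             | k <- iota 1 j]
  ++ flatten [seq join [:: v_ (2 * k - 1); v_ (2 * k)]
                       [:: v_ (2 * k + 1); v_ (2 * k + 2)]
             | k <- iota 1 (j - 1)]
  ++ join [:: v_ (2 * j - 1); v_ (2 * j)] [:: u_ (2 * j + 1); u_ (2 * j + 2)].

Definition graph_calH (j : nat) : rel 'I_(4 * j + 4) :=
  graph_of_edges (calH_edges j).

Arguments graph_calG : clear implicits.
Arguments graph_calH : clear implicits.

(* Main.v *)
Require Import Defs.
From mathcomp Require Import all_boot all_order all_algebra.
From mathcomp Require Import zify ring.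

Set Implicit Arguments.
Unset Strict Implicit.
Unset Printing Implicit Defensive.

(* The skew-adjacency matrix S is normal, the |d_i| of its eigenvalues d_i sum
   to 2n and their squares to tr (S^* S) = 4n; so all the |d_i| are 2 and
   S^* S = 4 I.  Orthogonality of the columns of S, whose entries are 0, 1 or
   -1, forces any two vertices to have an even number of common neighbours, and
   nothing else about the orientation is needed.

   If some two vertices are twins (have the same four neighbours), then twins
   propagate along edges.  Either three vertices are twins and the graph is
   K_{4,4}, or the graph is a cycle of length m >= 4 in which every vertex is
   doubled; this is H_j for m = 2j + 2 and G_i for m = 2i + 3.

   Without twins, two vertices with a common neighbour have exactly two.  Around
   a vertex x with neighbours a_1, ..., a_4 there are six vertices b_ij at
   distance two, indexed by the pairs {i, j}, and every further neighbour c of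
   b_12 is adjacent to exactly one of b_13, b_14 and one of b_23, b_24.  If c is
   adjacent to b_13, b_23 (or b_14, b_24) the graph is Q_4; otherwise it is the
   incidence graph of the 2-(7,4,2) design, which is G_3. *)

(** * From the skew energy to parities of common neighbourhoods *)

Section SkewSpectrum.
Import Order.TTheory GRing.Theory Num.Theory.
Local Open Scope ring_scope.
Local Open Scope sesquilinear_scope.

Lemma char_poly_conj (R : comUnitRingType) n (P A : 'M[R]_n) :
  P \in unitmx -> char_poly (invmx P *m A *m P) = char_poly A.
Proof.
move=> uP; rewrite /char_poly.
pose Q := map_mx polyC P; pose Q' := map_mx polyC (invmx P).
have QQ' : Q' *m Q = 1%:M by rewrite /Q /Q' -map_mxM mulVmx // map_mx1.
have -> : char_poly_mx (invmx P *m A *m P) = Q' *m char_poly_mx A *m Q.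
  rewrite /char_poly_mx mulmxBr mulmxBl !map_mxM; congr (_ - _).
  by rewrite mul_mx_scalar -scalemxAl QQ' scalemx1.
by rewrite !det_mulmx mulrAC -det_mulmx QQ' det1 mul1r.
Qed.

(** Both lists give the roots of [char_poly A]: by the spectral theorem [A] is similar to the
    diagonal matrix of [spectral_diag A], and a product of monic linear factors determines them up
    to order. *)
Lemma eigenvalues_normal (C : numClosedFieldType) n (A : 'M[C]_n) :
  A \is normalmx ->
  perm_eq (eigenvalues A) [seq spectral_diag A 0 i | i <- enum 'I_n].
Proof.
move=> /orthomx_spectralP eqA; apply: prod_XsubC_eq.
rewrite /eigenvalues; case: closed_field_poly_normal => s /= eqs.
move: (char_poly_monic A) eqs => /eqP-> ; rewrite scale1r => <-.
rewrite [in LHS]eqA char_poly_conj ?spectral_unit //.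
rewrite char_poly_trig ?diag_mx_is_trig // big_map big_enum /=.
by apply: eq_bigr => i _; rewrite !mxE eqxx.
Qed.

Section Optimum.
Variables (C : numClosedFieldType) (n : nat).

(* [tr (A^* A)] is the sum of the [|d_i|^2], so the sum of the [(|d_i| - r)^2]
   vanishes. *)
Lemma normal_extremal_trace_norm (A : 'M[C]_n) (r : C) :
  r \is Num.real -> A \is normalmx ->
  \sum_(z <- eigenvalues A) `|z| = n%:R * r ->
  \tr (A^t* *m A) = n%:R * r ^+ 2 ->
  A^t* *m A = (r ^+ 2)%:M.
Proof.
move=> r_real nA; rewrite (perm_big _ (eigenvalues_normal nA)) big_map big_enum /=.
move/orthomx_spectralP: nA; set P := spectralmx A; set d := spectral_diag A.
move=> eqA sum_d trA.
have uP : P \is unitarymx by apply: spectral_unitarymx.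
pose D := diag_mx (map_mx (fun z => `|z| ^+ 2) d).
have AA : A^t* *m A = invmx P *m D *m P.
  rewrite [in LHS]eqA !trmx_mul !map_mxM !mulmxA invmx_unitary //.
  rewrite trmxCK ![_ *m P *m _]mulmxtVK //; congr (_ *m _).
  rewrite -[LHS]mulmxA tr_diag_mx map_diag_mx mulmx_diag.
  congr (_ *m diag_mx _).
  by apply/rowP => i; rewrite !mxE normCK mulrC.
have trD : \tr D = n%:R * r ^+ 2.
  by rewrite -trA AA mxtrace_mulC mulmxA mulmxV ?mul1mx ?spectral_unit.
(* The two sums known about the [|d_i|] turn this into [n r^2 - 2 r (n r) + n r^2]. *)
have sum0 : \sum_i (`|d 0 i| - r) ^+ 2 = 0.
  under eq_bigr do rewrite sqrrB -mulrnAl -mulr_natl.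
  rewrite big_split /= sumrB -mulr_suml -mulr_sumr sum_d sumr_const card_ord.
  have -> : \sum_i `|d 0 i| ^+ 2 = n%:R * r ^+ 2.
    by rewrite -trD mxtrace_diag; apply: eq_bigr => i _; rewrite mxE.
  by rewrite -mulr_natl; ring.
have norm_d i : `|d 0 i| = r.
  have /psumr_eq0P/(_ sum0)/(_ i isT)/eqP :
      forall j, true -> 0 <= (`|d 0 j| - r) ^+ 2.
    by move=> j _; rewrite real_exprn_even_ge0 // realB.
  by rewrite sqrf_eq0 subr_eq0 => /eqP.
have -> : A^t* *m A = invmx P *m (r ^+ 2)%:M *m P.
  rewrite AA /D; congr (_ *m _ *m _).
  by rewrite -diag_const_mx; congr diag_mx; apply/rowP => i; rewrite !mxE norm_d.
by rewrite mul_mx_scalar -scalemxAl mulVmx ?spectral_unit // scalemx1.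
Qed.

Variables e arc : rel 'I_n.
Hypothesis e_arc : orientation e arc.
Let S := skew_adj C arc.

Lemma skew_adj_trmxC : S^t* = - S.
Proof.
apply/matrixP => i j; rewrite !mxE; have := e_arc.2 i j.
case: (arc i j); case: (arc j i) => // _.
- by rewrite rmorphN rmorph1.
- by rewrite opprK rmorph1.
- by rewrite rmorph0 oppr0.
Qed.

Lemma skew_adjC i j : S i j = - S j i.
Proof.
rewrite !mxE; have := e_arc.2 i j.
by case: (arc i j); case: (arc j i) => // _; rewrite ?opprK ?oppr0.
Qed.

Lemma skew_adj_sqr i j : S i j * S i j = (e i j)%:R.
Proof.
rewrite !mxE (e_arc.1 i j).
by case: (arc i j); case: (arc j i); rewrite ?mulrNN ?mulr1 ?mulr0.
Qed.

(** The extremal case with [r = sqrtC k]: [S] is normal because [S^* = - S], and the trace of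
    [S^* S] counts ordered pairs of adjacent vertices, [k] for each vertex. *)
Lemma skew_adj_gram k : (0 < n)%N -> regular k e ->
  optimum_skew_energy C e arc -> S^t* *m S = (k%:R)%:M.
Proof.
move=> n0 reg; rewrite /optimum_skew_energy.
have -> : max_degree e = k.
  apply/eqP; rewrite eqn_leq; apply/andP; split.
    by apply/bigmax_leqP => i _; rewrite reg.
  by rewrite -(reg (Ordinal n0)); apply: leq_bigmax.
move=> opt; rewrite -[k%:R]sqrtCK; apply: normal_extremal_trace_norm => //.
- by rewrite ger0_real // sqrtC_ge0 ler0n.
- by apply/normalmxP; rewrite skew_adj_trmxC mulNmx mulmxN.
rewrite skew_adj_trmxC sqrtCK.
have -> : n%:R * k%:R = \sum_(i < n) k%:R :> C.
  by rewrite sumr_const card_ord mulr_natl.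
apply: eq_bigr => i _; rewrite mulNmx !mxE -sumrN -(reg i) /degree.
rewrite -sum1_card natr_sum [RHS]big_mkcond /=; apply: eq_bigr => j _.
by rewrite -mulrN -skew_adjC skew_adj_sqr inE; case: (e i j).
Qed.

(* Distinct columns of [S] are orthogonal and the nonzero terms of their inner
   product are [1] or [-1], so these terms are even in number. *)
Lemma optimum_even_common k x y : (0 < n)%N -> regular k e ->
  optimum_skew_energy C e arc -> x != y ->
  ~~ odd #|[set z | e x z && e y z]|.
Proof.
move=> n0 reg opt xy.
have /matrixP/(_ x y) := skew_adj_gram n0 reg opt.
rewrite skew_adj_trmxC mulNmx !mxE (negPf xy) => /eqP.
rewrite mulr0n oppr_eq0.
(* [B] holds the terms equal to 1; the terms equal to -1 are those of [A :\: B], so orthogonality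
   makes these two sets equinumerous. *)
pose B := [set z | S x z * S z y == 1].
pose A := [set z | e x z && e y z].
have terms z : S x z * S z y = (z \in B)%:R - (z \in A :\: B)%:R.
  rewrite !inE !mxE (e_arc.1 x z) (e_arc.1 y z).
  have := e_arc.2 x z; have := e_arc.2 y z.
  have m1 : (-1 == 1 :> C) = false.
    by rewrite -subr_eq0 -opprD oppr_eq0; apply: (pnatr_eq0 C 2).
  have m0 : (0 == 1 :> C) = false by rewrite eq_sym oner_eq0.
  case: (arc x z); case: (arc z x); case: (arc y z); case: (arc z y) => //= _ _;
    rewrite ?mulrNN ?mulrN ?mulr1 ?mul1r ?mulr0 ?mul0r ?oppr0 ?eqxx ?m1 ?m0 /=;
    by rewrite ?subr0 ?sub0r ?subrr.
have sum_mem (X : {set 'I_n}) : \sum_z (z \in X)%:R = #|X|%:R :> C.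
  rewrite -sum1_card natr_sum [RHS]big_mkcond.
  by apply: eq_bigr => z _; case: (z \in X).
under eq_bigr do rewrite terms.
rewrite sumrB !sum_mem subr_eq0 eqr_nat => /eqP cardB.
rewrite (_ : [set z | e x z && e y z] = A) //.
have sBA : B \subset A.
  apply/subsetP => z; rewrite inE => zB; have := terms z.
  rewrite (eqP zB) !inE zB andFb subr0 => _; apply/negPn/negP => nA.
  move: zB; rewrite !mxE; move: nA.
  rewrite negb_and (e_arc.1 x z) (e_arc.1 y z) !negb_or.
  case: (arc x z); case: (arc z x); case: (arc y z); case: (arc z y) => //= _;
    by rewrite ?mulr0 ?mul0r eq_sym oner_eq0.
by rewrite -(cardsID B A) (setIidPr sBA) -cardB addnn odd_double.
Qed.

End Optimum.

End SkewSpectrum.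

(** * Computable adjacency and distance for graphs given by edge lists *)

Definition list_adj (E : seq (nat * nat)) (i j : nat) : bool :=
  ((i, j) \in E) || ((j, i) \in E).

Definition list_nbrs (E : seq (nat * nat)) (n i : nat) : seq nat :=
  [seq j <- iota 0 n | list_adj E i j].

(** The clauses are walks of length 1, 2 and 3. The remaining pairs, in [list_far], have to be
    separated by explicit adjacency facts. *)
Definition list_near (E : seq (nat * nat)) (n i j : nat) : bool :=
  [|| list_adj E i j,
      has (fun k => list_adj E k j) (list_nbrs E n i)
    | has (fun k => has (fun l => list_adj E l j) (list_nbrs E n k))
          (list_nbrs E n i)].

Definition list_far (E : seq (nat * nat)) (n : nat) : seq (nat * nat) :=
  [seq p <- [seq (i, j) | i <- iota 0 n, j <- iota 0 n]
     | (p.1 < p.2) && ~~ list_near E n p.1 p.2].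

(** A vertex of the cube is the number whose four binary digits are its coordinates. *)
Definition cube_edges : seq (nat * nat) :=
  [:: (0, 1); (0, 2); (0, 4); (0, 8); (1, 3); (1, 5); (1, 9); (2, 3); (2, 6);
      (2, 10); (3, 7); (3, 11); (4, 5); (4, 6); (4, 12); (5, 7); (5, 13);
      (6, 7); (6, 14); (7, 15); (8, 9); (8, 10); (8, 12); (9, 11); (9, 13);
      (10, 11); (10, 14); (11, 15); (12, 13); (12, 14); (13, 15); (14, 15)].

Definition bit (i k : nat) : bool := odd (i %/ 2 ^ k).

(** * The edge lists *)

Lemma graph_iso_trans (T1 T2 T3 : finType) (e1 : rel T1) (e2 : rel T2)
    (e3 : rel T3) : graph_iso e1 e2 -> graph_iso e2 e3 -> graph_iso e1 e3.
Proof.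
move=> [f [bf hf]] [g [bg hg]]; exists (g \o f).
by split=> [|x y /=]; [apply: bij_comp | rewrite hg hf].
Qed.

Lemma cube_edges_iso :
  graph_iso (graph_of_edges cube_edges : rel 'I_16) (hypercube 4).
Proof.
(* The Hamming distance of the binary expansions, in a form that evaluates, so that the two facts
   below are checked on all pairs. *)
pose dist i j := (bit i 0 != bit j 0) + ((bit i 1 != bit j 1) +
  ((bit i 2 != bit j 2) + (bit i 3 != bit j 3))).
have dist_adj : all (fun i => all (fun j =>
    (dist i j == 1) == list_adj cube_edges i j) (iota 0 16)) (iota 0 16).
  by vm_compute.
have dist_inj : all (fun i => all (fun j =>
    (dist i j == 0) ==> (i == j)) (iota 0 16)) (iota 0 16).
  by vm_compute.
have in16 (i : 'I_16) : val i \in iota 0 16 by rewrite mem_iota ltn_ord.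
pose f (i : 'I_16) : {ffun 'I_4 -> bool} := [ffun k : 'I_4 => bit i k].
have card_diff i j : #|[set k | f i k != f j k]| = dist i j.
  rewrite -sum1_card big_mkcond /= !big_ord_recl big_ord0 addn0 !inE !ffunE /=.
  by rewrite /bump /dist; do 4 case: (_ != _).
exists f; split=> [|i j].
  apply: inj_card_bij; last by rewrite card_ord card_ffun card_ord card_bool.
  move=> i j eq_f; apply/val_inj/eqP.
  have /implyP := allP (allP dist_inj i (in16 i)) j (in16 j); apply.
  by rewrite -card_diff eq_f cards_eq0; apply/eqP/setP => k; rewrite !inE eqxx.
rewrite /hypercube card_diff.
have /eqP adj := allP (allP dist_adj i (in16 i)) j (in16 j).
exact: adj.
Qed.

Lemma mem_join (A B : seq nat) a b :
  ((a, b) \in join A B) = (a \in A) && (b \in B).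
Proof.
apply/allpairsP/andP => [[[x y] [xA yB [-> ->]]] //|[aA bB]].
by exists (a, b).
Qed.

Lemma mem_flatten_iota (S : eqType) (F : nat -> seq S) k l z :
  reflect (exists2 h, k <= h < k + l & z \in F h)
    (z \in flatten [seq F h | h <- iota k l]).
Proof.
apply: (iffP flatten_mapP) => [[h]|[h hk zF]].
  by rewrite mem_iota; exists h.
by exists h; rewrite ?mem_iota.
Qed.

Definition cyc (m i j : nat) : bool :=
  [|| j == i.+1, i == j.+1, (i == 0) && (j.+1 == m) | (j == 0) && (i.+1 == m)].

(* Halving the numbers of the vertices groups them into pairs u v, u_1 u_2,
   u_3 u_4, ..., v_1 v_2, ...; the graph joins consecutive pairs of a cycle
   which goes up through the u's and comes back down through the v's, so the
   position of a pair on the cycle is obtained by reversing the v's. *)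
Definition flip (p m h : nat) : nat := if h <= p then h else p + m - h.

(* Edges between consecutive pairs, except for those joining the last pair of
   u's, number [p], to the last pair of v's, number [m.-1]. *)
Definition ladder (p m h h' : nat) : bool :=
  [|| (h == 0) && ((h' == 1) || (h' == p.+1)),
      (h' == h.+1) && (0 < h < p) | (h' == h.+1) && (p < h < m.-1)].

Lemma cycC m i j : cyc m i j = cyc m j i.
Proof.
rewrite /cyc orbA orbA (orbC (j == _)) -orbA -orbA.
by congr [|| _, _ | _]; rewrite orbC.
Qed.

(** [flip] exchanges [p.+1] and [m.-1]. The closing edge of the cycle thus becomes the edge from
    pair 0 to the first pair of v's, and the step from [p] to [p.+1] becomes the edge between the
    two last pairs. *)
Lemma cyc_flip p m h h' : 0 < p -> p.+1 < m -> h < m -> h' < m ->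
  cyc m (flip p m h) (flip p m h') =
  ladder p m h h' || ladder p m h' h ||
  ((h == p) && (h' == m.-1) || (h' == p) && (h == m.-1)).
Proof.
move=> p0 pm; wlog hh : h h' / h <= h'.
  move=> IH hm h'm; have [le|/ltnW le] := leqP h h'; first exact: IH.
  rewrite cycC IH // (orbC (ladder _ _ h' h)); congr (_ || _); exact: orbC.
move=> hm h'm.
have -> : ladder p m h' h = false by rewrite /ladder; lia.
have -> : (h' == p) && (h == m.-1) = false by lia.
rewrite !orbF /flip; case: (leqP h' p) => h'p.
  rewrite (leq_trans hh h'p).
  have -> : cyc m h h' = (h' == h.+1) by rewrite /cyc; lia.
  by rewrite /ladder; lia.
case: (leqP h p) => hp.
  have -> : cyc m h (p + m - h') =
      (h == 0) && (h' == p.+1) || (h == p) && (h' == m.-1).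
    by rewrite /cyc; lia.
  by rewrite /ladder; lia.
have -> : cyc m (p + m - h) (p + m - h') = (h' == h.+1) by rewrite /cyc; lia.
by rewrite /ladder; lia.
Qed.

Lemma mem_calG_edges i a b : 0 < i ->
  ((a, b) \in calG_edges i) = ladder i.+1 (2 * i + 3) a./2 b./2 ||
    ((a, b) \in [:: (2 * i + 2, 4 * i + 5); (4 * i + 5, 2 * i + 3);
                    (2 * i + 3, 4 * i + 4); (4 * i + 4, 2 * i + 2)]).
Proof.
move=> i0; rewrite /calG_edges mem_cat mem_join mem_cat orbA.
rewrite /vtx_u /vtx_v /vtx_ui /vtx_vi; congr (_ || _); last first.
  by congr (_ \in [:: (_, _); (_, _); (_, _); (_, _)]); lia.
congr (_ || _); first by rewrite !inE; lia.
rewrite -andb_orr.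
apply/mem_flatten_iota/idP => [[k ki]|].
  by rewrite mem_cat !mem_join !inE; lia.
move=> /andP[/eqP eq_b /orP[ai|ai]].
  (* The [k]-th pair of u's has number [k] and the [k]-th pair of v's has number [i.+1 + k], whence
     the two witnesses. *)
  exists a./2; first lia.
  by rewrite mem_cat !mem_join !inE; lia.
exists (a./2 - i.+1); first lia.
by rewrite mem_cat !mem_join !inE; lia.
Qed.

(** The four edges of the final 4-cycle are listed in mixed directions; once symmetrised they are
    all the edges between the two last pairs. *)
Lemma calG_adj i a b : 0 < i -> a < 4 * i + 6 -> b < 4 * i + 6 ->
  list_adj (calG_edges i) a b =
  cyc (2 * i + 3) (flip i.+1 (2 * i + 3) a./2) (flip i.+1 (2 * i + 3) b./2).
Proof.
move=> i0 an bn; rewrite cyc_flip; try lia.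
rewrite /list_adj !mem_calG_edges // orbACA; congr (_ || _).
have half_eq c k : (c./2 == k) = (c == k.*2) || (c == k.*2.+1) by lia.
rewrite !half_eq.
have -> : i.+1.*2 = 2 * i + 2 by lia.
have -> : (2 * i + 3).-1.*2 = 4 * i + 4 by lia.
have -> : 4 * i + 5 = (4 * i + 4).+1 by lia.
have -> : 2 * i + 3 = (2 * i + 2).+1 by lia.
rewrite !inE !xpair_eqE.
by do 8 case: (_ == _).
Qed.

Lemma mem_calH_edges j a b : 0 < j ->
  ((a, b) \in calH_edges j) = ladder j.+1 (2 * j + 2) a./2 b./2 ||
    (b./2 == j.+1) && (a./2 == (2 * j + 2).-1).
Proof.
move=> j0; rewrite /calH_edges mem_cat mem_join mem_cat.
rewrite [X in _ || (_ || X)]mem_cat mem_join /vtx_u /vtx_v /vtx_ui /vtx_vi.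
rewrite /ladder -!orbA; congr [|| _, _, _ | _].
- by rewrite !inE; lia.
- apply/mem_flatten_iota/idP => [[k ki]|ai].
    by rewrite !mem_join !inE; lia.
  by exists a./2; rewrite ?mem_join ?inE; lia.
- apply/mem_flatten_iota/idP => [[k ki]|ai].
    by rewrite !mem_join !inE; lia.
  by exists (a./2 - j.+1); rewrite ?mem_join ?inE; lia.
by rewrite !inE; lia.
Qed.

Lemma calH_adj j a b : 0 < j -> a < 4 * j + 4 -> b < 4 * j + 4 ->
  list_adj (calH_edges j) a b =
  cyc (2 * j + 2) (flip j.+1 (2 * j + 2) a./2) (flip j.+1 (2 * j + 2) b./2).
Proof.
move=> j0 an bn; rewrite cyc_flip; try lia.
rewrite /list_adj !mem_calH_edges // orbACA; congr (_ || _); exact: orbC.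
Qed.

(** * Graphs with even numbers of common neighbours *)

Section Graph.
Variables (T : finType) (e : rel T).
Hypotheses (e_sym : symmetric e) (e_irr : irreflexive e).
Hypothesis (e_deg : regular 4 e).
Hypothesis e_tri : triangle_free e.
Hypothesis e_conn : forall x y, connect e x y.

Lemma adj_neq z x y : e z x -> ~~ e z y -> x != y.
Proof. by move=> zx; apply: contra => /eqP <-. Qed.

Lemma adj_neq_self x y : e x y -> x != y.
Proof. by move=> xy; apply/eqP => eq_xy; rewrite eq_xy e_irr in xy. Qed.

Lemma nbrs4 x a b c d z : uniq [:: a; b; c; d] ->
  e x a -> e x b -> e x c -> e x d -> e x z = (z \in [:: a; b; c; d]).
Proof.
move=> u xa xb xc xd.
have sub : [:: a; b; c; d] \subset [set y | e x y].
  by apply/subsetP => y; rewrite !inE => /or4P[] /eqP->.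
have card : #|[set y | e x y]| <= #|[:: a; b; c; d]|.
  by rewrite (card_uniqP u); move: (e_deg x); rewrite /degree => ->.
have : mem [:: a; b; c; d] =i mem [set y | e x y].
  apply/subset_cardP => //.
  by apply/eqP; rewrite eqn_leq card subset_leq_card.
by move/(_ z); rewrite !inE => ->.
Qed.

(** Lifting of neighbours makes the image of [f] closed under adjacency, hence everything by
    connectedness; with injectivity it also makes [f] reflect adjacency. *)
Lemma graph_iso_of_hom (T1 : finType) (e1 : rel T1) (f : T1 -> T) (x0 : T1) :
  injective f -> (forall x y, e1 x y -> e (f x) (f y)) ->
  (forall x z, e (f x) z -> exists2 y, e1 x y & f y = z) ->
  graph_iso e e1.
Proof.
move=> f_inj f_hom f_lift.
have f_surj z : z \in codom f.
  have cl : closed e (mem (codom f)).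
    apply: intro_closed => [|y y' /= yy' /codomP[x eq_y]].
      by apply: sym_connect_sym.
    by move: yy'; rewrite eq_y => /f_lift[y2 _ <-]; apply: codom_f.
  by rewrite -(closed_connect cl (e_conn (f x0) z)); apply: codom_f.
exists (fun z => iinv (f_surj z)); split.
  exists f => [z|x]; first exact: f_iinv.
  by apply: f_inj; rewrite f_iinv.
move=> x y; move: (iinv _) (iinv _) (f_iinv (f_surj x)) (f_iinv (f_surj y)).
move=> x' y' <- <-.
apply/idP/idP; first exact: f_hom.
by case/f_lift => z adj /f_inj <-.
Qed.

(** * Recognising a graph from an enumeration of its vertices *)

Section Lists.
Variables (E : seq (nat * nat)) (n : nat) (s : seq T) (x0 : T).
Hypothesis s_size : size s = n.
Hypothesis s_hom : all (fun p => e (nth x0 s p.1) (nth x0 s p.2)) E.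

Lemma list_adj_hom i j : list_adj E i j -> e (nth x0 s i) (nth x0 s j).
Proof. by case/orP => /(allP s_hom) //=; rewrite e_sym. Qed.

(** Non-edges need no check: the four list neighbours of [i] have distinct images, which by
    regularity exhaust the neighbours of the image of [i]. *)
Lemma graph_iso_of_list : 0 < n -> uniq s ->
  all (fun i => size (list_nbrs E n i) == 4) (iota 0 n) ->
  graph_iso e (graph_of_edges E : rel 'I_n).
Proof.
move=> n0 s_uniq s_deg.
pose f (i : 'I_n) := nth x0 s i.
apply: (@graph_iso_of_hom _ _ f (Ordinal n0)).
- move=> i j /eqP; rewrite nth_uniq ?s_size // => /eqP; apply: val_inj.
- by move=> i j; apply: list_adj_hom.
move=> i z iz.
have /(allP s_deg)/eqP size4 : val i \in iota 0 n by rewrite mem_iota ltn_ord.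
have nbr j : j \in list_nbrs E n i -> j < n /\ list_adj E i j.
  by rewrite mem_filter mem_iota => /andP[].
have nbrs_uniq : uniq (list_nbrs E n i) by apply: filter_uniq; apply: iota_uniq.
case eq_nbrs : (list_nbrs E n i) size4 nbr nbrs_uniq
  => [|a [|b [|c [|d []]]]] //= _ nbr nbrs_uniq.
have adj j : j \in [:: a; b; c; d] -> e (f i) (nth x0 s j).
  by case/nbr => _; apply: list_adj_hom.
have : z \in map (nth x0 s) [:: a; b; c; d].
  rewrite /= -(@nbrs4 (f i)) //; try (apply: adj; by rewrite !inE eqxx ?orbT).
  rewrite (_ : [:: _; _; _; _] = map (nth x0 s) [:: a; b; c; d]) //.
  rewrite map_inj_in_uniq // => j k /nbr[jn _] /nbr[kn _] /eqP.
  by rewrite nth_uniq ?s_size // => /eqP.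
by case/mapP => j /nbr[jn ij] ->; exists (Ordinal jn).
Qed.

(* Vertices joined by a walk of length 1 or 3 in the list graph have distinct
   images because the target has no loop and no triangle. *)
Lemma uniq_of_list :
  all (fun l => uniq (map (nth x0 s) l)) (map (list_nbrs E n) (iota 0 n)) ->
  all (fun p => nth x0 s p.1 != nth x0 s p.2) (list_far E n) ->
  uniq s.
Proof.
move=> s_loc s_far; apply/(uniqP x0).
have main i j : i < j -> j < n -> nth x0 s i != nth x0 s j.
  move=> ij jn; have in_n : i < n by apply: ltn_trans jn.
  have [|nnear] := boolP (list_near E n i j); last first.
    have : (i, j) \in list_far E n.
      rewrite mem_filter /= ij nnear /=; apply: allpairs_f; by rewrite mem_iota.
    by move/(allP s_far).
  have nbr k l : l \in list_nbrs E n k -> l < n /\ e (nth x0 s k) (nth x0 s l).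
    by rewrite mem_filter mem_iota => /andP[/list_adj_hom].
  case/or3P => [/list_adj_hom/adj_neq_self //|/hasP[k ik kj]|].
    have [kn _] := nbr _ _ ik.
    have ki : list_adj E k i.
      by move: ik; rewrite mem_filter /list_adj orbC => /andP[].
    have /(map_f (list_nbrs E n))/(allP s_loc) u : k \in iota 0 n.
      by rewrite mem_iota.
    have k_i : i \in list_nbrs E n k by rewrite mem_filter ki mem_iota.
    have k_j : j \in list_nbrs E n k by rewrite mem_filter kj mem_iota.
    rewrite -(nth_index 0 k_i) -(nth_index 0 k_j) -!(nth_map 0 x0) ?index_mem //.
    rewrite nth_uniq ?size_map ?index_mem //; apply: contraTneq ij.
    move/(congr1 (nth 0 (list_nbrs E n k))); rewrite !nth_index // => ->.
    by rewrite ltnn.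
  move/hasP => [k /nbr[kn ik] /hasP[l /nbr[ln kl] /list_adj_hom lj]].
  apply/eqP => eq_ij; rewrite -eq_ij in lj.
  by apply: (e_tri (And3 ik kl lj)).
move=> i j; rewrite !inE s_size => ni nj.
case: (ltngtP i j) => // lt_ij /eqP; last rewrite eq_sym.
all: by rewrite (negPf (main _ _ lt_ij _)).
Qed.
End Lists.

(* [neq] separates two vertices by a third one adjacent to only one of them. *)
Ltac adj := solve [assumption | rewrite e_sym; assumption].
Ltac neq := solve [assumption | rewrite eq_sym; assumption
  | match goal with
    | |- is_true (?x != ?y) =>
      match goal with
      | H : is_true (~~ e ?z x) |- _ =>
          rewrite eq_sym; apply: (@adj_neq z _ _ _ H); adj
      | H : is_true (~~ e ?z y) |- _ => apply: (@adj_neq z _ _ _ H); adj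
      | H : is_true (~~ e x ?z) |- _ =>
          rewrite eq_sym; apply: (@adj_neq z); [adj | rewrite e_sym; exact H]
      | H : is_true (~~ e y ?z) |- _ =>
          apply: (@adj_neq z); [adj | rewrite e_sym; exact H]
      end
    end].
Ltac solve_uniq :=
  rewrite /= ?inE ?negb_or ?andbT -?andbA; repeat (apply/andP; split); neq.
Ltac solve_facts := solve [adj | neq |
  rewrite /= ?inE ?negb_or ?andbT -?andbA; repeat (apply/andP; split);
  solve [adj | neq]].
Ltac compute_arg t := let v := eval vm_compute in t in change t with v.

Definition nbr (x : T) : {set T} := [set y | e x y].

Lemma nbr_enum4 x : exists a b c d,
  [/\ uniq [:: a; b; c; d], e x a, e x b, e x c & e x d].
Proof.
have := enum_uniq (nbr x); have : size (enum (nbr x)) = 4.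
  by rewrite -cardE; apply: e_deg.
have adj y : y \in enum (nbr x) -> e x y by rewrite mem_enum inE.
case: (enum (nbr x)) adj => [|a [|b [|c [|d []]]]] //= adj _ u.
by exists a, b, c, d; split=> //; apply: adj; rewrite !inE eqxx ?orbT.
Qed.

Hypothesis e_even : forall x y, x != y -> ~~ odd #|[set z | e x z && e y z]|.

(** [x] is one common neighbour of [a] and [b], so parity provides a second. *)
Lemma square x a b : e x a -> e x b -> a != b ->
  exists y, [/\ y != x, e a y & e b y].
Proof.
move=> xa xb ab; have := e_even ab.
rewrite (cardsD1 x) inE e_sym xa e_sym xb /=.
rewrite negbK => /odd_gt0/card_gt0P[y].
by rewrite !inE => /and3P[yx ay yb]; exists y.
Qed.

(** By parity three common neighbours force a fourth, and four are all the neighbours of either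
    vertex. *)
Lemma twin_of_common3 x y a b c : x != y -> uniq [:: a; b; c] ->
  e x a -> e x b -> e x c -> e y a -> e y b -> e y c -> nbr x = nbr y.
Proof.
move=> xy u xa xb xc ya yb yc.
set X := [set z | e x z && e y z].
have X3 : 3 <= #|X|.
  rewrite -[3]/(size [:: a; b; c]) -(card_uniqP u) subset_leq_card //.
  by apply/subsetP => z; rewrite !inE => /or3P[]/eqP->; apply/andP.
have X4 : 4 <= #|X|.
  by move: X3 (e_even xy); rewrite leq_eqVlt => /orP[/eqP <-|].
have eqX z : X \subset nbr z -> X = nbr z.
  by move=> sub; apply/eqP; rewrite eqEcard sub [#|nbr z|]e_deg.
transitivity X; [apply/esym/eqX | apply/eqX].
all: by apply/subsetP => z; rewrite !inE => /andP[].
Qed.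

(** * Graphs without twins: the hypercube and [G_3] *)

Section NoTwins.
Hypothesis no_twins : forall x y, nbr x = nbr y -> x = y.

Lemma common_le2 x y a b c : x != y -> uniq [:: a; b; c] ->
  e x a -> e x b -> e x c -> e y a -> e y b -> ~~ e y c.
Proof.
move=> xy u xa xb xc ya yb; apply/negP => yc.
have /no_twins eq_xy := twin_of_common3 xy u xa xb xc ya yb yc.
by rewrite eq_xy eqxx in xy.
Qed.

(** Serves to identify vertices produced by separate uses of [corner_link]. *)
Lemma common_eq x y a b c : x != y -> a != b -> a != c ->
  e x a -> e x b -> e x c -> e y a -> e y b -> e y c -> b = c.
Proof.
move=> xy ab ac xa xb xc ya yb; apply: contraTeq => bc.
by apply: (@common_le2 x y a b c) => //; rewrite /= !inE negb_or ab ac bc.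
Qed.

Section Center.
Variable x : T.

(** The vertex [b_ij] when [p], [q] are the neighbours [a_i], [a_j] of the centre [x]; without twins
    it is the only choice. *)
Definition corner (p q : T) : T :=
  odflt x [pick z | [&& z != x, e p z & e q z]].

Lemma cornerC p q : corner p q = corner q p.
Proof.
by congr odflt; apply: eq_pick => z /=; rewrite (andbC (e p z)).
Qed.

Lemma cornerP p q : e x p -> e x q -> p != q ->
  [/\ corner p q != x, e p (corner p q) & e q (corner p q)].
Proof.
move=> xp xq pq; rewrite /corner; case: pickP => [z /and3P[] //|nz].
by have [y [yx py qy]] := square xp xq pq; move: (nz y); rewrite yx py qy.
Qed.

(** [x] and the corner already share [p] and [q]; sharing [r] as well would make them twins. *)
Lemma corner_nadj p q r : e x p -> e x q -> e x r -> uniq [:: p; q; r] ->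
  ~~ e r (corner p q).
Proof.
move=> xp xq xr u; have pq : p != q.
  by move: u; rewrite /= inE negb_or -!andbA => /and3P[].
have [bx pb qb] := cornerP xp xq pq.
by rewrite e_sym (@common_le2 x _ p q r) // 1?eq_sym // e_sym.
Qed.

Section Link.
Variables p q r s : T.
Hypotheses (u : uniq [:: p; q; r; s]).
Hypotheses (xp : e x p) (xq : e x q) (xr : e x r) (xs : e x s).

(* The two neighbours [c], [c'] of [corner p q] other than [p] and [q]: each of
   them picks one corner at [p] and one corner at [q]. *)
Lemma corner_link : exists c c',
  [/\ e c (corner p q) /\ e c' (corner p q), c != p /\ c' != p,
      e c (corner p r), e c' (corner p s) &
      e c (corner q r) /\ e c' (corner q s) \/
      e c (corner q s) /\ e c' (corner q r)].
Proof.
have [[/norP[npq /norP[npr nps]] /norP[nqr nqs] nrs]] :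
    [/\ ~~ [|| p == q, p == r | p == s], ~~ ((q == r) || (q == s)) & r != s].
  by move: u; rewrite /= !inE andbT => /and3P[].
have ub a b c : a != b -> a != c -> b != c -> uniq [:: a; b; c].
  by rewrite /= !inE negb_or => -> -> ->.
have [_ p_pq q_pq] := cornerP xp xq npq.
have [_ p_pr r_pr] := cornerP xp xr npr.
have [_ p_ps s_ps] := cornerP xp xs nps.
have [_ q_qr r_qr] := cornerP xq xr nqr.
have [_ q_qs s_qs] := cornerP xq xs nqs.
have r_pq : ~~ e r (corner p q) by apply: corner_nadj; rewrite ?ub.
have s_pq : ~~ e s (corner p q) by apply: corner_nadj; rewrite ?ub.
have q_pr : ~~ e q (corner p r) by apply: corner_nadj; rewrite ?ub // eq_sym.
have q_ps : ~~ e q (corner p s) by apply: corner_nadj; rewrite ?ub // eq_sym.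
have s_pr : ~~ e s (corner p r) by apply: corner_nadj; rewrite ?ub.
have p_qr : ~~ e p (corner q r) by apply: corner_nadj; rewrite ?ub // eq_sym.
have p_qs : ~~ e p (corner q s) by apply: corner_nadj; rewrite ?ub // eq_sym.
have s_qr : ~~ e s (corner q r) by apply: corner_nadj; rewrite ?ub // eq_sym.
have pq_pr : corner p q != corner p r by apply: adj_neq q_pq q_pr.
have pq_ps : corner p q != corner p s by apply: adj_neq q_pq q_ps.
have pr_ps : corner p r != corner p s by rewrite eq_sym (adj_neq s_ps).
have pq_qr : corner p q != corner q r by apply: adj_neq p_pq p_qr.
have pq_qs : corner p q != corner q s by apply: adj_neq p_pq p_qs.
have qr_qs : corner q r != corner q s by rewrite eq_sym (adj_neq s_qs).
(* Seen from [p], the two further neighbours of [corner p q] are [c] and [c']; seen from [q], they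
   are [d] and [d']. Matching the two descriptions gives the alternative. *)
have [c [cp pq_c pr_c]] := square p_pq p_pr pq_pr.
have [c' [c'p pq_c' ps_c']] := square p_pq p_ps pq_ps.
have [d [dq pq_d qr_d]] := square q_pq q_qr pq_qr.
have [d' [d'q pq_d' qs_d']] := square q_pq q_qs pq_qs.
have c_ps : ~~ e c (corner p s).
  by apply: (@common_le2 p c (corner p q) (corner p r)); first [adj | neq | solve_uniq].
have d_qs : ~~ e d (corner q s).
  by apply: (@common_le2 q d (corner p q) (corner q r)); first [adj | neq | solve_uniq].
have dd' : d != d' by neq.
have in_pq y : e (corner p q) y -> y != p -> y != q -> y = c \/ y = c'.
  rewrite (@nbrs4 _ p q c c'); try adj; last by solve_uniq.
  by rewrite !inE => /or4P[] /eqP->; rewrite ?eqxx //; auto.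
exists c, c'; split; try split; try adj.
have [eq_d eq_d'] : (d = c \/ d = c') /\ (d' = c \/ d' = c').
  by split; apply: in_pq; neq.
case: eq_d => eq_d; case: eq_d' => eq_d'; subst.
- by rewrite eqxx in dd'.
- by left; split; adj.
- by right; split; adj.
- by rewrite eqxx in dd'.
Qed.
End Link.

Lemma cube_or_G3 : graph_iso e (hypercube 4) \/ graph_iso e graph_G3.
Proof.
have [a1 [a2 [a3 [a4 [u xa1 xa2 xa3 xa4]]]]] := nbr_enum4 x.
have [ne12 [ne13 [ne14 [ne23 [ne24 ne34]]]]] : a1 != a2 /\ a1 != a3 /\ a1 != a4 /\
    a2 != a3 /\ a2 != a4 /\ a3 != a4.
  by move: u; rewrite /= !inE !negb_or andbT -!andbA => /and5P[? ? ? ? /andP[]].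
have [b12x a1b12 a2b12] := cornerP xa1 xa2 ne12.
have [b13x a1b13 a3b13] := cornerP xa1 xa3 ne13.
have [b14x a1b14 a4b14] := cornerP xa1 xa4 ne14.
have [b23x a2b23 a3b23] := cornerP xa2 xa3 ne23.
have [b24x a2b24 a4b24] := cornerP xa2 xa4 ne24.
have [b34x a3b34 a4b34] := cornerP xa3 xa4 ne34.
have a3b12 : ~~ e a3 (corner a1 a2) by apply: corner_nadj => //; solve_uniq.
have a4b12 : ~~ e a4 (corner a1 a2) by apply: corner_nadj => //; solve_uniq.
have a2b13 : ~~ e a2 (corner a1 a3) by apply: corner_nadj => //; solve_uniq.
have a4b13 : ~~ e a4 (corner a1 a3) by apply: corner_nadj => //; solve_uniq.
have a2b14 : ~~ e a2 (corner a1 a4) by apply: corner_nadj => //; solve_uniq.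
have a3b14 : ~~ e a3 (corner a1 a4) by apply: corner_nadj => //; solve_uniq.
have a1b23 : ~~ e a1 (corner a2 a3) by apply: corner_nadj => //; solve_uniq.
have a4b23 : ~~ e a4 (corner a2 a3) by apply: corner_nadj => //; solve_uniq.
have a1b24 : ~~ e a1 (corner a2 a4) by apply: corner_nadj => //; solve_uniq.
have a3b24 : ~~ e a3 (corner a2 a4) by apply: corner_nadj => //; solve_uniq.
have a1b34 : ~~ e a1 (corner a3 a4) by apply: corner_nadj => //; solve_uniq.
have a2b34 : ~~ e a2 (corner a3 a4) by apply: corner_nadj => //; solve_uniq.
have L1234 := @corner_link a1 a2 a3 a4 ltac:(solve_uniq) xa1 xa2 xa3 xa4.
have L1324 := @corner_link a1 a3 a2 a4 ltac:(solve_uniq) xa1 xa3 xa2 xa4.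
have L1423 := @corner_link a1 a4 a2 a3 ltac:(solve_uniq) xa1 xa4 xa2 xa3.
have L2314 := @corner_link a2 a3 a1 a4 ltac:(solve_uniq) xa2 xa3 xa1 xa4.
rewrite !(cornerC a3 a2) !(cornerC a4 a2) !(cornerC a4 a3) in L1324 L1423 L2314.
rewrite !(cornerC a2 a1) !(cornerC a3 a1) in L2314.
generalize dependent (corner a1 a2); intros b12; intros.
generalize dependent (corner a1 a3); intros b13; intros.
generalize dependent (corner a1 a4); intros b14; intros.
generalize dependent (corner a2 a3); intros b23; intros.
generalize dependent (corner a2 a4); intros b24; intros.
generalize dependent (corner a3 a4); intros b34; intros.
have [c [c' [[cb12 c'b12] [ca1 c'a1] cb13 c'b14 [[cb23 c'b24]|[cb24 c'b23]]]]] := L1234.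
- (* [c] meets the corners of a triangle of pairs: a cube opens up at [x]. *)
  left.
  have [c1 [d [[c1b13 db13] [c1a1 da1] c1b12 db14 H]]] := L1324.
  (* [b12] and [b13] already share [a1], which leaves room for only one other common neighbour. *)
  have eq_c : c1 = c by apply: (@common_eq b12 b13 a1); solve_facts.
  subst c1.
  have cb34 : ~~ e c b34 by apply: (@common_le2 a3 c b13 b23); solve_facts.
  have db34 : e d b34 by case: H => [[]|[]] //; rewrite (negPf cb34).
  have [c2 [f [[c2b23 fb23] [c2a2 fa2] c2b12 fb24 H2]]] := L2314.
  have eq_c : c2 = c by apply: (@common_eq b12 b23 a2); solve_facts.
  subst c2.
  have fb34 : e f b34 by case: H2 => [[]|[]] //; rewrite (negPf cb34).
  have cb14 : ~~ e c b14 by apply: (@common_le2 a1 c b12 b13); solve_facts.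
  have cb24 : ~~ e c b24 by apply: (@common_le2 a2 c b12 b23); solve_facts.
  have c'b13 : ~~ e c' b13 by apply: (@common_le2 a1 c' b12 b14); solve_facts.
  have c'b23 : ~~ e c' b23 by apply: (@common_le2 a2 c' b12 b24); solve_facts.
  have c'b34 : ~~ e c' b34 by apply: (@common_le2 a4 c' b14 b24); solve_facts.
  have db12 : ~~ e d b12 by apply: (@common_le2 a1 d b13 b14); solve_facts.
  have db23 : ~~ e d b23 by apply: (@common_le2 a3 d b13 b34); solve_facts.
  have db24 : ~~ e d b24 by apply: (@common_le2 a4 d b14 b34); solve_facts.
  have fb12 : ~~ e f b12 by apply: (@common_le2 a2 f b23 b24); solve_facts.
  have fb13 : ~~ e f b13 by apply: (@common_le2 a3 f b23 b34); solve_facts.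
  have fb14 : ~~ e f b14 by apply: (@common_le2 a4 f b24 b34); solve_facts.
  (* [y] will be the vertex opposite [x]. It is the fourth neighbour of [c], so the second common
     neighbour of [c] with [d], and with [f], must again be [y]. *)
  have [y [yb12 cy c'y]] : exists y, [/\ y != b12, e c y & e c' y].
    by apply: (@square b12); solve_facts.
  have c_nbrs z : e c z -> ~~ (z \in [:: b12; b13; b23]) -> z = y.
    rewrite (@nbrs4 c b12 b13 b23 y); try solve_facts.
    by rewrite !inE => /or4P[] /eqP->; rewrite ?eqxx ?orbT.
  have dy : e d y.
    have [z [zb13 cz dz]] : exists z, [/\ z != b13, e c z & e d z].
      by apply: (@square b13); solve_facts.
    by rewrite -(c_nbrs z cz) //; solve_facts.
  have fy : e f y.
    have [z [zb23 cz fz]] : exists z, [/\ z != b23, e c z & e f z].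
      by apply: (@square b23); solve_facts.
    by rewrite -(c_nbrs z cz) //; solve_facts.
  have xc : ~~ e x c by rewrite (nbrs4 c u) //; solve_facts.
  apply: graph_iso_trans cube_edges_iso.
  (* The binary digits of a position are the indices of its vertex: [a_i] has one, [b_ij] two, [c],
     [c'], [d], [f] omit 4, 3, 2, 1 respectively, and [y] has all four. *)
  pose s := [:: x; a1; a2; b12; a3; b13; b23; c; a4; b14; b24; c'; b34; d; f; y].
  have s_hom : all (fun p => e (nth x s p.1) (nth x s p.2)) cube_edges.
    by rewrite /=; solve_facts.
  apply: (@graph_iso_of_list _ 16 s x erefl s_hom isT) => //.
  apply: (@uniq_of_list _ 16 s x erefl s_hom).
    compute_arg (map (list_nbrs cube_edges 16) (iota 0 16)).
    rewrite /all /map /nth /s; solve_facts.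
  compute_arg (list_far cube_edges 16); rewrite /=; solve_facts.
- right.
  have cb14 : ~~ e c b14 by apply: (@common_le2 a1 c b12 b13); solve_facts.
  have c'b13 : ~~ e c' b13 by apply: (@common_le2 a1 c' b12 b14); solve_facts.
  have [c1 [d [[c1b13 db13] [c1a1 da1] c1b12 db14 H]]] := L1324.
  have eq_c : c1 = c by apply: (@common_eq b12 b13 a1); solve_facts.
  subst c1.
  have b23c : ~~ e b23 c by apply: (@common_le2 b12 b23 a2 c'); solve_facts.
  have b24c' : ~~ e b24 c' by apply: (@common_le2 b12 b24 a2 c); solve_facts.
  have [cb34 db23] : e c b34 /\ e d b23.
    by case: H => [[]|[]] //; rewrite e_sym (negPf b23c).
  have [c2 [d2 [[c2b14 d2b14] [c2a1 d2a1] c2b12 d2b13 H2]]] := L1423.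
  have eq_c : c2 = c' by apply: (@common_eq b12 b14 a1); solve_facts.
  have eq_d : d2 = d by apply: (@common_eq b13 b14 a1); solve_facts.
  subst c2 d2.
  have [c'b34 db24] : e c' b34 /\ e d b24.
    by case: H2 => [[]|[]] //; rewrite e_sym (negPf b24c').
  have db12 : ~~ e d b12 by apply: (@common_le2 a1 d b13 b14); solve_facts.
  have db34 : ~~ e d b34 by apply: (@common_le2 a3 d b13 b23); solve_facts.
  (* The order is that of [u, v, u_1, ..., u_6, v_1, ..., v_5, w]. One side of the bipartition is
     [x] with the six corners, the other is the [a_i] with [c], [c'], [d]. *)
  pose s := [:: x; b12; a1; a2; b13; b14; c; c'; a3; a4; b23; b24; d; b34].
  have s_hom : all (fun p => e (nth x s p.1) (nth x s p.2)) G3_edges.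
    by rewrite /=; solve_facts.
  apply: (@graph_iso_of_list _ 14 s x erefl s_hom isT) => //.
  (* [G_3] has diameter 3, so its [list_far] is empty. *)
  apply: (@uniq_of_list _ 14 s x erefl s_hom); last by [].
  compute_arg (map (list_nbrs G3_edges 14) (iota 0 14)).
  rewrite /all /map /nth /s; solve_facts.
Qed.
End Center.
End NoTwins.

(** * Graphs with twins: doubled cycles *)

Lemma twin_adj x y z : nbr x = nbr y -> e z x = e z y.
Proof. by move/setP/(_ z); rewrite !inE !(e_sym z). Qed.

Lemma twin_adjl x y z : nbr x = nbr y -> e x z = e y z.
Proof. by move/(@twin_adj x y z); rewrite !(e_sym z). Qed.

(** Any two neighbours of [x] share [x], [y] and [z], so they are twins too and the graph is
    complete bipartite. *)
Lemma three_twins x y z : uniq [:: x; y; z] -> nbr x = nbr y -> nbr x = nbr z ->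
  graph_iso e (graph_calH 1).
Proof.
move=> u eq_xy eq_xz; have [a1 [a2 [a3 [a4 [ua xa1 xa2 xa3 xa4]]]]] := nbr_enum4 x.
have nbr_a b : e x b -> nbr b = nbr a1.
  move=> xb; have [-> //|ba] := eqVneq b a1.
  apply: (twin_of_common3 ba u); rewrite -?(twin_adj _ eq_xy) -?(twin_adj _ eq_xz);
    by rewrite e_sym.
have [x1 [x2 [x3 [x4 [ux ax1 ax2 ax3 ax4]]]]] := nbr_enum4 a1.
(* In [H_1] the sides are [u, v, u_3, u_4] and [u_1, u_2, v_1, v_2]. *)
pose s := [:: x1; x2; a1; a2; x3; x4; a3; a4].
have adj b w : e a1 w -> e x b -> e w b.
  by move=> aw xb; rewrite (twin_adj _ (nbr_a _ xb)) e_sym.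
have s_hom : all (fun p => e (nth x s p.1) (nth x s p.2)) (calH_edges 1).
  rewrite /=; repeat (apply/andP; split) => //;
    solve [by apply: adj | by rewrite e_sym; apply: adj].
apply: (@graph_iso_of_list _ 8 s x erefl s_hom isT) => //.
apply: (@uniq_of_list _ 8 s x erefl s_hom); last by [].
compute_arg (map (list_nbrs (calH_edges 1) 8) (iota 0 8)).
rewrite [all]lock /= -lock; by rewrite /all ux ua.
Qed.

Section Twins.
Hypothesis no_three_twins : forall x y z, uniq [:: x; y; z] ->
  nbr x = nbr y -> nbr x <> nbr z.

(** Take a neighbour [z] of [p] outside [x], [y]. The second common neighbour [q] of [x] and [z] is
    also adjacent to [y], so [p] and [q] share three neighbours. *)
Lemma twin_nbr x y p : x != y -> nbr x = nbr y -> e x p ->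
  exists2 q, q != p & nbr q = nbr p.
Proof.
move=> xy eq_xy xp; have [a1 [a2 [a3 [a4 [u pa1 pa2 pa3 pa4]]]]] := nbr_enum4 p.
have [z [zx zy pz]] : exists z, [/\ z != x, z != y & e p z].
  have : 0 < #|nbr p :\: [set x; y]|.
    rewrite cardsD subn_gt0 [#|nbr p|]e_deg.
    by apply: leq_ltn_trans (subset_leq_card (subsetIr _ _)) _; rewrite cards2 xy.
  by case/card_gt0P => z; rewrite !inE negb_or -andbA => /and3P[]; exists z.
have px : e p x by rewrite e_sym.
have xz : x != z by rewrite eq_sym.
have [q [qp xq zq]] := square px pz xz.
exists q => //; apply: (@twin_of_common3 q p x y z) => //.
- by rewrite /= !inE negb_or xy xz eq_sym zy.
- by rewrite e_sym.
- by rewrite e_sym -(twin_adjl _ eq_xy).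
- by rewrite e_sym.
- by rewrite -(twin_adj _ eq_xy).
Qed.

Variables x0 y0 : T.
Hypotheses (xy0 : x0 != y0) (eq_xy0 : nbr x0 = nbr y0).

Definition twin (x : T) : T := odflt x [pick y | (y != x) && (nbr y == nbr x)].

(** Having a twin passes to neighbours by [twin_nbr], and connectedness carries it from [x0] to
    every vertex. *)
Lemma twinP x : twin x != x /\ nbr (twin x) = nbr x.
Proof.
pose A := [pred x | [exists y, (y != x) && (nbr y == nbr x)]].
have clA : closed e A.
  apply: intro_closed => [|p q pq /existsP[y /andP[yp /eqP eq_y]]].
    exact: sym_connect_sym.
  have py : p != y by rewrite eq_sym.
  have [z zq eq_z] := twin_nbr py (esym eq_y) pq.
  by apply/existsP; exists z; rewrite zq eq_z eqxx.
have : x \in A.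
  rewrite -(closed_connect clA (e_conn x0 x)).
  by apply/existsP; exists y0; rewrite eq_sym xy0 eq_xy0 eqxx.
case/existsP => y xy; rewrite /twin.
by case: pickP => [z /andP[zx /eqP]|/(_ y)]; last rewrite xy.
Qed.

Lemma twin_cases x y : nbr y = nbr x -> y = x \/ y = twin x.
Proof.
move=> eq_yx; have [tx eq_tx] := twinP x.
have [|yx] := eqVneq y x; first by left.
have [|yt] := eqVneq y (twin x); first by right.
case: (@no_three_twins x y (twin x)) => //.
by rewrite /= !inE negb_or (eq_sym x) yx (eq_sym x) tx yt.
Qed.

Lemma twin_neq x y : nbr x != nbr y -> [/\ x != y, x != twin y & twin x != twin y].
Proof.
move=> nxy; have [_ eq_x] := twinP x; have [_ eq_y] := twinP y.
split; apply/eqP => eq_xy; case/eqP: nxy; first by rewrite eq_xy.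
  by rewrite eq_xy.
by rewrite -eq_x eq_xy.
Qed.

(** Thus the graph of twin classes is 2-regular. *)
Lemma twin_nbrs p q r : e q p -> e q r -> nbr p != nbr r -> forall z,
  e q z = (z \in [:: p; twin p; r; twin r]).
Proof.
move=> qp qr npr z; have [tp eq_p] := twinP p; have [tr eq_r] := twinP r.
have [pr ptr tptr] := twin_neq npr.
have [_ rtp _] : [/\ r != p, r != twin p & twin r != twin p].
  by apply: twin_neq; rewrite eq_sym.
apply: nbrs4; rewrite ?(twin_adj _ eq_p) ?(twin_adj _ eq_r) //.
by rewrite /= !inE !negb_or (eq_sym p) tp pr ptr (eq_sym _ r) rtp tptr (eq_sym r) tr.
Qed.

Lemma twin_next p q : e p q -> exists2 r, e q r & nbr r != nbr p.
Proof.
move=> pq; have [tp eq_p] := twinP p.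
have : 0 < #|nbr q :\: [set p; twin p]|.
  rewrite cardsD subn_gt0 [#|nbr q|]e_deg.
  by apply: leq_ltn_trans (subset_leq_card (subsetIr _ _)) _; rewrite cards2 eq_sym tp.
case/card_gt0P => r; rewrite !inE negb_or -andbA => /and3P[rp rt qr].
by exists r => //; apply/eqP => /twin_cases[] eq_r; rewrite eq_r eqxx in rp rt.
Qed.

Lemma nonbacktracking_walk : exists c : nat -> T,
  (forall k, e (c k) (c k.+1)) /\ (forall k, nbr (c k.+2) != nbr (c k)).
Proof.
pose nxt p q := odflt q [pick r | e q r && (nbr r != nbr p)].
have nxtP p q : e p q -> e q (nxt p q) /\ nbr (nxt p q) != nbr p.
  move=> pq; rewrite /nxt; case: pickP => [r /andP[] //|nr].
  by have [r qr rp] := twin_next pq; move: (nr r); rewrite qr rp.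
have [a [_ [_ [_ [_ x0a _ _ _]]]]] := nbr_enum4 x0.
(* The state is the current edge of the walk, as choosing the next vertex requires the previous
   one. *)
pose st k := iter k (fun pq => (pq.2, nxt pq.1 pq.2)) (x0, a).
have st_adj k : e (st k).1 (st k).2.
  by elim: k => //= k /nxtP[].
exists (fun k => (st k).1); split=> [k|k]; first exact: st_adj.
by have [] := nxtP _ _ (st_adj k).
Qed.

(* Take the first return [c m] of the walk to a previous twin class.  It
   returns to the class of [c 0], since the two classes adjacent to any later
   [c i] are those of [c i.-1] and [c i.+1]. *)
Lemma twin_cycle : exists m (c : nat -> T),
  [/\ 3 < m, forall k, e (c k) (c k.+1), nbr (c m) = nbr (c 0)
    & forall i j, i < j < m -> nbr (c i) != nbr (c j)].
Proof.
have [c [c_adj c_nb]] := nonbacktracking_walk.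
pose P m := [exists i : 'I_m, nbr (c m) == nbr (c i)].
have exP : exists m, P m.
  have ninj : ~~ injectiveb (fun k : 'I_#|T|.+1 => c k).
    by apply/negP => /injectiveP/leq_card; rewrite card_ord ltnn.
  have [i [j [ij eq_ij]]] : exists i j, i < j /\ c i = c j.
    case/injectivePn: ninj => i [j ij eq_ij].
    have : val i != val j by [].
    by case: ltngtP => // ltij _; [exists i, j | exists j, i].
  by exists j; apply/existsP; exists (Ordinal ij); rewrite /= eq_ij.
pose m := ex_minn exP; have : P m by rewrite /m; case: ex_minnP.
have min_m k : P k -> m <= k by rewrite /m; case: ex_minnP => ? _; apply.
have dist i j : i < j < m -> nbr (c i) != nbr (c j).
  case/andP => ij jm; apply: contraTneq jm => eq_ij; rewrite -leqNgt.
  by apply: min_m; apply/existsP; exists (Ordinal ij); rewrite /= eq_ij.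
case/existsP => -[i im] /= /eqP eq_mi.
have c_neq i1 : nbr (c i1) != nbr (c i1.+1).
  apply/eqP => eq_i; have := c_adj i1.
  by rewrite (twin_adjl _ eq_i) e_irr.
have i0 : i = 0.
  case: i im eq_mi => // i; case: (m) dist => // m' dist im eq_mi.
  have adj_m : e (c i.+1) (c m') by rewrite -(twin_adjl _ eq_mi) e_sym.
  have adj_i : e (c i.+1) (c i) by rewrite e_sym.
  have ci : nbr (c i) != nbr (c i.+2) by rewrite eq_sym.
  have : nbr (c m') = nbr (c i) \/ nbr (c m') = nbr (c i.+2).
    move: adj_m; rewrite (twin_nbrs adj_i (c_adj _) ci) !inE.
    have [_ t1] := twinP (c i); have [_ t2] := twinP (c i.+2).
    by case/or4P => /eqP ->; rewrite ?t1 ?t2; auto.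
  case => eq_m'.
    by have := dist i m'; rewrite eq_m' eqxx ltnSn -ltnS im => /(_ isT).
  case: (ltngtP i.+2 m') => [lt_i|lt_i|eq_i].
  - by have := dist i.+2 m'; rewrite eq_m' eqxx ltnSn lt_i => /(_ isT).
  - have eq_i : m' = i.+1 by lia.
    by have := c_neq i.+1; rewrite -eq_mi eq_i eqxx.
  - by have := c_nb i.+1; rewrite eq_i -eq_mi eqxx.
subst i; exists m, c; split=> //.
(* Length 1 would put adjacent vertices in one class, length 2 is a backtrack, and length 3 closes a
   triangle. *)
case: (m) im eq_mi => [|[|[|[|n]]]] // _ eq_m.
- by have := c_neq 0; rewrite eq_m eqxx.
- by have := c_nb 0; rewrite eq_m eqxx.
- case: (@e_tri (c 0) (c 1) (c 2)); split=> //.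
  by rewrite -(twin_adj _ eq_m).
Qed.

(** * The isomorphism with a doubled cycle *)

Section CycleIso.
Variables (m : nat) (c : nat -> T).
Hypotheses (m_gt3 : 3 < m) (c_adj : forall k, e (c k) (c k.+1)).
Hypothesis c_close : nbr (c m) = nbr (c 0).
Hypothesis c_dist : forall i j, i < j < m -> nbr (c i) != nbr (c j).

Lemma cycle_inj i j : i < m -> j < m -> nbr (c i) = nbr (c j) -> i = j.
Proof.
move=> im jm eq_ij; case: (ltngtP i j) => // lt_ij.
  by have := @c_dist i j; rewrite lt_ij jm eq_ij eqxx => /(_ isT).
by have := @c_dist j i; rewrite lt_ij im eq_ij eqxx => /(_ isT).
Qed.

Lemma cyc_adj i j : i < m -> j < m -> cyc m i j -> e (c i) (c j).
Proof.
move=> im jm /or4P[/eqP->|/eqP->|/andP[/eqP-> /eqP eq_m]|/andP[/eqP-> /eqP eq_m]].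
- exact: c_adj.
- by rewrite e_sym.
- by rewrite -(twin_adjl _ c_close) -eq_m e_sym.
- by rewrite -(twin_adj _ c_close) -eq_m.
Qed.

Lemma adj_cyc i z : i < m -> e (c i) z ->
  exists j, [/\ j < m, cyc m i j & nbr z = nbr (c j)].
Proof.
move=> im iz.
(* The cyclic predecessor and successor of [i]; their classes are distinct and account for all four
   neighbours. *)
pose j1 := if i == 0 then m.-1 else i.-1; pose j2 := if i.+1 == m then 0 else i.+1.
have [j1m c1] : j1 < m /\ cyc m i j1 by rewrite /j1 /cyc; case: eqP; lia.
have [j2m c2] : j2 < m /\ cyc m i j2 by rewrite /j2 /cyc; case: eqP; lia.
have n12 : nbr (c j1) != nbr (c j2).
  apply/eqP => /(cycle_inj j1m j2m); rewrite /j1 /j2; case: eqP; case: eqP; lia.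
move: iz; rewrite (twin_nbrs (cyc_adj im j1m c1) (cyc_adj im j2m c2) n12) !inE.
have [_ t1] := twinP (c j1); have [_ t2] := twinP (c j2).
by case/or4P => /eqP->; [exists j1 | exists j1 | exists j2 | exists j2].
Qed.

Lemma flip_lt p h : p < m -> h < m -> flip p m h < m.
Proof. by rewrite /flip => pm hm; case: (leqP h p); lia. Qed.

Lemma flipK p h : p < m -> h < m -> flip p m (flip p m h) = h.
Proof. by rewrite /flip => pm hm; case: (leqP h p) => hp; case: leqP; lia. Qed.

(** The half of a number selects a twin class, through its position on the cycle, and the parity
    selects a member of that class. *)
Lemma blowup_iso N (e1 : rel 'I_N) p : N = 2 * m -> p < m ->
  (forall x y : 'I_N, e1 x y = cyc m (flip p m x./2) (flip p m y./2)) ->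
  graph_iso e e1.
Proof.
move=> eqN pm e1E; pose pos (x : 'I_N) := flip p m x./2.
have half_lt (x : 'I_N) : x./2 < m by have := ltn_ord x; lia.
have pos_lt x : pos x < m by apply: flip_lt.
pose f (x : 'I_N) := if odd x then twin (c (pos x)) else c (pos x).
have nbr_f x : nbr (f x) = nbr (c (pos x)).
  by rewrite /f; case: odd => //; have [] := twinP (c (pos x)).
have N0 : 0 < N by lia.
apply: (@graph_iso_of_hom _ _ f (Ordinal N0)).
- move=> x y eq_f; have eq_pos : pos x = pos y.
    by apply: cycle_inj; rewrite // -!nbr_f eq_f.
  have eq_half : x./2 = y./2 by rewrite -(flipK pm (half_lt x)) -/(pos x) eq_pos flipK.
  have [tn _] := twinP (c (pos y)).
  apply: val_inj; rewrite /= -(odd_double_half x) -(odd_double_half y) eq_half.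
  move: eq_f; rewrite /f eq_pos; case: (odd x); case: (odd y) => // eq_t.
    by rewrite eq_t eqxx in tn.
  by rewrite -eq_t eqxx in tn.
- move=> x y; rewrite e1E => xy.
  by rewrite (twin_adj _ (nbr_f y)) (twin_adjl _ (nbr_f x)) cyc_adj.
move=> x z; rewrite (twin_adjl _ (nbr_f x)) => /(adj_cyc (pos_lt x))[j [jm xj eq_z]].
have lift b : exists2 y : 'I_N, e1 x y & (pos y = j /\ odd y = b).
  have yN : b + (flip p m j).*2 < N by have := flip_lt pm jm; case: b; lia.
  exists (Ordinal yN); first by rewrite e1E /= half_bit_double flipK.
  by rewrite /pos /= half_bit_double flipK // oddD odd_double oddb addbF.
case: (twin_cases eq_z) => ->.
  by have [y xy [yj yb]] := lift false; exists y; rewrite // /f yb yj.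
by have [y xy [yj yb]] := lift true; exists y; rewrite // /f yb yj.
Qed.

End CycleIso.

Lemma twins_classification :
  (exists i, 0 < i /\ graph_iso e (graph_calG i)) \/
  (exists j, 0 < j /\ graph_iso e (graph_calH j)).
Proof.
have [m [c [m3 c_adj c_close c_dist]]] := twin_cycle.
have [odd_m|even_m] := boolP (odd m).
  left; exists (m - 3)./2; set i := (m - 3)./2.
  have [i0 eq_m] : 0 < i /\ m = 2 * i + 3 by rewrite /i; lia.
  split=> //; clearbody i; subst m.
  (* [p] is the number of the last pair of u's, where [flip] turns around. *)
  apply: (blowup_iso m3 c_adj c_close c_dist (p := i.+1)); [lia | lia |].
  by move=> x y; rewrite -calG_adj.
right; exists (m - 2)./2; set j := (m - 2)./2.
have [j0 eq_m] : 0 < j /\ m = 2 * j + 2 by rewrite /j; lia.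
split=> //; clearbody j; subst m.
apply: (blowup_iso m3 c_adj c_close c_dist (p := j.+1)); [lia | lia |].
by move=> x y; rewrite -calH_adj.
Qed.

End Twins.

Theorem even_common_nbrs_classification (x0 : T) :
  [\/ graph_iso e (hypercube 4),
      graph_iso e graph_G3,
      exists i : nat, 0 < i /\ graph_iso e (graph_calG i)
    | exists j : nat, 0 < j /\ graph_iso e (graph_calH j)].
Proof.
have [/existsP[x /existsP[y /andP[xy /eqP eq_xy]]]|no_twins] :=
    boolP [exists x, exists y, (x != y) && (nbr x == nbr y)]; last first.
  have nt x y : nbr x = nbr y -> x = y.
    move=> eq_xy; apply: contraNeq no_twins => xy.
    by apply/existsP; exists x; apply/existsP; exists y; rewrite xy eq_xy eqxx.
  by case: (cube_or_G3 nt x0) => ?; [apply: Or41 | apply: Or42].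
have [/existsP[a /existsP[b /existsP[c /and3P[u /eqP ab /eqP ac]]]]|no_three] :=
  boolP [exists a, exists b, exists c,
    [&& uniq [:: a; b; c], nbr a == nbr b & nbr a == nbr c]].
  by apply: Or44; exists 1; split=> //; apply: three_twins u ab ac.
have n3 a b c : uniq [:: a; b; c] -> nbr a = nbr b -> nbr a <> nbr c.
  move=> u ab ac; case/negP: no_three; apply/existsP; exists a; apply/existsP.
  by exists b; apply/existsP; exists c; rewrite u ab -ac ab eqxx.
by case: (twins_classification n3 xy eq_xy) => ?; [apply: Or43 | apply: Or44].
Qed.

End Graph.

Theorem theorem3p2 (C : numClosedFieldType) (n : nat) (e arc : rel 'I_n)
    (e_simple : simple_graph e) (e_connected : connected_graph e)
    (e_arc : orientation e arc) (e_regular : regular 4 e)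
    (e_optimum : optimum_skew_energy C e arc)
    (e_triangle_free : triangle_free e) :
  [\/ graph_iso e (hypercube 4),
      graph_iso e graph_G3,
      exists i : nat, 0 < i /\ graph_iso e (graph_calG i)
    | exists j : nat, 0 < j /\ graph_iso e (graph_calH j)].
Proof.
have [n_gt0 conn] := e_connected; rewrite card_ord in n_gt0.
have [e_sym e_irr] := e_simple.
apply: (even_common_nbrs_classification e_sym e_irr e_regular e_triangle_free conn).
  by move=> x y; apply: (optimum_even_common e_arc n_gt0 e_regular e_optimum).
exact: Ordinal n_gt0.
Qed.
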